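(* There is an effective procedure which, given a natural number $n$ and a sentence $\phi$ in the first-order language of complemented lattices, produces a sentence $\phi^*$ in the first-order language of the field of real numbers such that $L(\mathbb{C}^n)\models\phi$ if and only if $\mathbb{R}\models\phi^*$.
   Context: $L(\mathbb{C}^n)$ denotes the lattice of all subspaces of $\mathbb{C}^n$ ordered by inclusion, with meet $p\wedge q=p\cap q$, join $p\vee q=$ the span of $p\cup q$, and complement $\bar p=$ the orthogonal complement of $p$ with respect to the standard Hermitian inner product. The first-order language of complemented lattices has the binary function symbols $\wedge,\vee$, the unary function symbol $\bar{\ }$ and equality. The first-order theory of $\mathbb{R}$ refers to first-order sentences in the language of ordered fields ($+,\cdot,0,1,<,=$) interpreted in the real numbers. *)

(* Defs.v *)
From Stdlib Require List.
From mathcomp Require Import all_boot all_order all_algebra.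
From mathcomp Require Import reals complex.

Set Implicit Arguments.
Unset Strict Implicit.
Unset Printing Implicit Defensive.

Import Order.TTheory GRing.Theory Num.Theory.

(* [A] is the type of atomic formulas; variables are named by natural numbers. *)

Inductive formula (A : Type) : Type :=
| FAtom of A
| FNot of formula A
| FAnd of formula A & formula A
| FOr of formula A & formula A
| FImp of formula A & formula A
| FForall of nat & formula A
| FExists of nat & formula A.

Fixpoint formula_fv (A : Type) (atom_fv : A -> seq nat) (phi : formula A)
    : seq nat :=
  match phi with
  | FAtom a => atom_fv a
  | FNot p => formula_fv atom_fv p
  | FAnd p q | FOr p q | FImp p q => formula_fv atom_fv p ++ formula_fv atom_fv q
  | FForall x p | FExists x p => [seq y <- formula_fv atom_fv p | y != x]
  end.

Record sentence (A : Type) (atom_fv : A -> seq nat) := Sentence {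
  sentence_formula :> formula A;
  sentence_closed : formula_fv atom_fv sentence_formula = [::]
}.

Fixpoint holds (A D : Type) (atom_holds : (nat -> D) -> A -> Prop)
    (v : nat -> D) (phi : formula A) : Prop :=
  match phi with
  | FAtom a => atom_holds v a
  | FNot p => ~ holds atom_holds v p
  | FAnd p q => holds atom_holds v p /\ holds atom_holds v q
  | FOr p q => holds atom_holds v p \/ holds atom_holds v q
  | FImp p q => holds atom_holds v p -> holds atom_holds v q
  | FForall x p => forall d : D, holds atom_holds [eta v with x |-> d] p
  | FExists x p => exists d : D, holds atom_holds [eta v with x |-> d] p
  end.

Inductive lattice_term : Type :=
| LVar of nat
| LMeet of lattice_term & lattice_term
| LJoin of lattice_term & lattice_term
| LCompl of lattice_term.

Inductive lattice_atom : Type :=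
| LEq of lattice_term & lattice_term.

Fixpoint lattice_term_fv (t : lattice_term) : seq nat :=
  match t with
  | LVar x => [:: x]
  | LMeet s t | LJoin s t => lattice_term_fv s ++ lattice_term_fv t
  | LCompl t => lattice_term_fv t
  end.

Definition lattice_atom_fv (a : lattice_atom) : seq nat :=
  let: LEq s t := a in lattice_term_fv s ++ lattice_term_fv t.

Definition lattice_sentence := sentence lattice_atom_fv.

Inductive field_term : Type :=
| RVar of nat
| RZero
| ROne
| RAdd of field_term & field_term
| RMul of field_term & field_term.

Inductive field_atom : Type :=
| REq of field_term & field_term
| RLt of field_term & field_term.

Fixpoint field_term_fv (t : field_term) : seq nat :=
  match t with
  | RVar x => [:: x]
  | RZero | ROne => [::]
  | RAdd s t | RMul s t => field_term_fv s ++ field_term_fv t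
  end.

Definition field_atom_fv (a : field_atom) : seq nat :=
  match a with
  | REq s t | RLt s t => field_term_fv s ++ field_term_fv t
  end.

Definition field_sentence := sentence field_atom_fv.

Section Structures.
Local Open Scope ring_scope.
Variable R : realType.

(* [dotmx] is the standard Hermitian inner product on row vectors, and
   [orthov] the orthogonal complement with respect to a Hermitian form. *)
Fixpoint subspace_eval (n : nat) (v : nat -> {vspace 'rV[R[i]]_n})
    (t : lattice_term) : {vspace 'rV[R[i]]_n} :=
  match t with
  | LVar x => v x
  | LMeet s t => (subspace_eval v s :&: subspace_eval v t)%VS
  | LJoin s t => (subspace_eval v s + subspace_eval v t)%VS
  | LCompl t => orthov (@dotmx R[i] n) (subspace_eval v t)
  end.

Definition subspace_atom_holds (n : nat) (v : nat -> {vspace 'rV[R[i]]_n})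
    (a : lattice_atom) : Prop :=
  let: LEq s t := a in subspace_eval v s = subspace_eval v t.

Fixpoint real_eval (v : nat -> R) (t : field_term) : R :=
  match t with
  | RVar x => v x
  | RZero => 0
  | ROne => 1
  | RAdd s t => real_eval v s + real_eval v t
  | RMul s t => real_eval v s * real_eval v t
  end.

Definition real_atom_holds (v : nat -> R) (a : field_atom) : Prop :=
  match a with
  | REq s t => real_eval v s = real_eval v t
  | RLt s t => real_eval v s < real_eval v t
  end.

(* Both domains are nonempty, so for a sentence truth under all assignments
   is the same as truth under any one of them. *)
Definition subspaces_model (n : nat) (phi : lattice_sentence) : Prop :=
  forall v, holds (@subspace_atom_holds n) v phi.

Definition reals_model (phi : field_sentence) : Prop :=
  forall v, holds real_atom_holds v phi.

End Structures.

(* Codes for the partial recursive functions: zero, successor, projections,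
   composition, primitive recursion on the first argument, minimisation over
   a new first argument. *)
Inductive recfun : Type :=
| RecZero
| RecSucc
| RecProj of nat
| RecComp of recfun & seq recfun
| RecPrim of recfun & recfun
| RecMin of recfun.

(* [computes c xs y]: the program [c] halts on the arguments [xs] with
   value [y].  A code used at a wrong arity may fail to halt. *)
Inductive computes : recfun -> seq nat -> nat -> Prop :=
| computes_zero xs : computes RecZero xs 0
| computes_succ x : computes RecSucc [:: x] x.+1
| computes_proj i xs : i < size xs -> computes (RecProj i) xs (nth 0 xs i)
| computes_comp f gs xs ys y :
    List.Forall2 (fun g z => computes g xs z) gs ys ->
    computes f ys y -> computes (RecComp f gs) xs y
| computes_prim0 f g xs y :
    computes f xs y -> computes (RecPrim f g) (0 :: xs) y
| computes_primS f g k xs z y :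
    computes (RecPrim f g) (k :: xs) z -> computes g (k :: z :: xs) y ->
    computes (RecPrim f g) (k.+1 :: xs) y
| computes_min f xs m :
    (forall k, k < m -> exists z, computes f (k :: xs) z.+1) ->
    computes f (m :: xs) 0 -> computes (RecMin f) xs m.

(* The Cantor pairing function. *)
Definition cpair (x y : nat) : nat := 'C((x + y).+1, 2) + y.

Fixpoint formula_code (A : Type) (atom_code : A -> nat) (phi : formula A)
    : nat :=
  match phi with
  | FAtom a => cpair 0 (atom_code a)
  | FNot p => cpair 1 (formula_code atom_code p)
  | FAnd p q =>
      cpair 2 (cpair (formula_code atom_code p) (formula_code atom_code q))
  | FOr p q =>
      cpair 3 (cpair (formula_code atom_code p) (formula_code atom_code q))
  | FImp p q =>
      cpair 4 (cpair (formula_code atom_code p) (formula_code atom_code q))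
  | FForall x p => cpair 5 (cpair x (formula_code atom_code p))
  | FExists x p => cpair 6 (cpair x (formula_code atom_code p))
  end.

Fixpoint lattice_term_code (t : lattice_term) : nat :=
  match t with
  | LVar x => cpair 0 x
  | LMeet s t => cpair 1 (cpair (lattice_term_code s) (lattice_term_code t))
  | LJoin s t => cpair 2 (cpair (lattice_term_code s) (lattice_term_code t))
  | LCompl t => cpair 3 (lattice_term_code t)
  end.

Definition lattice_atom_code (a : lattice_atom) : nat :=
  let: LEq s t := a in cpair (lattice_term_code s) (lattice_term_code t).

Fixpoint field_term_code (t : field_term) : nat :=
  match t with
  | RVar x => cpair 0 x
  | RZero => cpair 1 0
  | ROne => cpair 2 0
  | RAdd s t => cpair 3 (cpair (field_term_code s) (field_term_code t))
  | RMul s t => cpair 4 (cpair (field_term_code s) (field_term_code t))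
  end.

Definition field_atom_code (a : field_atom) : nat :=
  match a with
  | REq s t => cpair 0 (cpair (field_term_code s) (field_term_code t))
  | RLt s t => cpair 1 (cpair (field_term_code s) (field_term_code t))
  end.

(* A translation is effective if some partial recursive function computes
   the Goedel number of the output from [n] and that of the input. *)
Definition effective (star : nat -> lattice_sentence -> field_sentence)
    : Prop :=
  exists c : recfun, forall (n : nat) (phi : lattice_sentence),
    computes c [:: n; formula_code lattice_atom_code phi]
               (formula_code field_atom_code (star n phi)).

(* Main.v *)
Require Import Defs.
From mathcomp Require Import all_boot all_order all_algebra.
From mathcomp Require Import reals complex.
From Stdlib Require List.
From mathcomp Require Import boolp zify ring.

Set Implicit Arguments.
Unset Strict Implicit.
Unset Printing Implicit Defensive.

Import Order.TTheory GRing.Theory Num.Theory.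

(** A subspace of [C^n] is the set of vectors orthogonal to the rows of some
    [n] by [n] matrix, so a quantifier over subspaces is a block of [2 n^2]
    quantifiers over reals, and every choice of reals is allowed.  Membership
    of a vector [z] in the value of a lattice term is then expressed by
    recursion on the term: [z] lies in [s /\ t] iff it lies in both, [z] lies in
    the complement of [t] iff it is orthogonal to all vectors of [t], and
    [s \/ t] is the complement of the meet of the complements.  An equation
    says that the two sides have the same vectors.  Two alternating auxiliary
    vectors suffice, since the formula for [z] in the complement of [t]
    quantifies over the other vector and then no longer needs [z] inside the
    formula for [t]; so no fresh names are needed and the translation is a
    course-of-values recursion on the code of the input. *)

(** * Recursive functions *)

(* [e i] is the [i]-th argument; as opposed to [nth 0 xs i] it commutes with
   shifts of the arguments by conversion. *)
Definition recursive (k : nat) (f : (nat -> nat) -> nat) : Prop :=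
  exists c, forall e, computes c (mkseq e k) (f e).

Definition env_cons (x : nat) (e : nat -> nat) (i : nat) : nat :=
  if i is j.+1 then e j else x.

Lemma mkseq_env_cons x e k : mkseq (env_cons x e) k.+1 = x :: mkseq e k.
Proof. by rewrite /mkseq /= (iotaDl 1 0) -map_comp. Qed.

Lemma computes_proj_mkseq k i e :
  i < k -> computes (RecProj i) (mkseq e k) (e i).
Proof.
move=> ik; rewrite -[X in computes _ _ X](nth_mkseq 0 e ik).
by constructor; rewrite size_mkseq.
Qed.

Lemma computes_projs k e s :
  all (ltn^~ k) s ->
  List.Forall2 (fun g z => computes g (mkseq e k) z)
    [seq RecProj i | i <- s] [seq e i | i <- s].
Proof.
elim: s => [|i s IH] /=; first by constructor.
by move=> /andP[ik sk]; constructor; [apply: computes_proj_mkseq | apply: IH].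
Qed.

Lemma recursive_proj k i : i < k -> recursive k (fun e => e i).
Proof. by move=> ik; exists (RecProj i) => e; apply: computes_proj_mkseq. Qed.

Lemma recursive_succ k f : recursive k f -> recursive k (fun e => (f e).+1).
Proof.
move=> [c cP]; exists (RecComp RecSucc [:: c]) => e.
by apply: computes_comp (computes_succ _); do !constructor.
Qed.

Lemma recursive_const k n : recursive k (fun=> n).
Proof.
elim: n => [|n IH]; last exact: recursive_succ IH.
by exists RecZero => e; constructor.
Qed.

(** Projections hand the arguments [e] on to the primitive recursion as parameters; its step reads
    the counter and the previous value first, hence the shift by two. *)
Lemma recursive_rec k m b s :
  recursive k m -> recursive k b ->
  recursive k.+2 (fun e => s (e 0) (e 1) (fun i => e i.+2)) ->
  recursive k (fun e => nat_rect (fun=> nat) (b e) (fun i r => s i r e) (m e)).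
Proof.
move=> [cm mP] [cb bP] [cs sP].
exists (RecComp (RecPrim cb cs) (cm :: [seq RecProj i | i <- iota 0 k])) => e.
have prim j : computes (RecPrim cb cs) (j :: mkseq e k)
    (nat_rect (fun=> nat) (b e) (fun i r => s i r e) j).
  elim: j => [|j IH]; first by constructor.
  apply: computes_primS IH _ => /=.
  set r := nat_rect _ _ _ _.
  by have := sP (env_cons j (env_cons r e)); rewrite !mkseq_env_cons.
apply: computes_comp (prim _); constructor; first exact: mP.
by apply: computes_projs; apply/allP => i; rewrite mem_iota.
Qed.

Lemma recursive_subst k a b g :
  recursive k.+2 (fun e => g (e 0) (e 1) (fun i => e i.+2)) ->
  recursive k a -> recursive k b -> recursive k (fun e => g (a e) (b e) e).
Proof.
move=> [cg gP] [ca aP] [cb bP].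
exists (RecComp cg (ca :: cb :: [seq RecProj i | i <- iota 0 k])) => e.
have := gP (env_cons (a e) (env_cons (b e) e)); rewrite !mkseq_env_cons /=.
apply: computes_comp; constructor; first exact: aP.
constructor; first exact: bP.
by apply: computes_projs; apply/allP => i; rewrite mem_iota.
Qed.

Lemma recursive_ext k f g : f =1 g -> recursive k f -> recursive k g.
Proof. by move=> fg [c cP]; exists c => e; rewrite -fg. Qed.

Lemma recursive_pred k f : recursive k f -> recursive k (fun e => (f e).-1).
Proof.
move=> rf; apply: (@recursive_ext _
  (fun e => nat_rect (fun=> nat) 0 (fun i r => i) (f e))).
  by move=> e; case: (f e).
apply: recursive_rec => //; first exact: recursive_const.
exact: recursive_proj.
Qed.

Lemma recursive_add k f g :
  recursive k f -> recursive k g -> recursive k (fun e => f e + g e).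
Proof.
move=> rf rg; apply: (@recursive_ext _
  (fun e => nat_rect (fun=> nat) (f e) (fun i r => r.+1) (g e))).
  by move=> e; elim: (g e) => [|j IH] /=; [lia | rewrite IH; lia].
by apply: recursive_rec => //; apply: recursive_succ; apply: recursive_proj.
Qed.

Lemma recursive_sub k f g :
  recursive k f -> recursive k g -> recursive k (fun e => f e - g e).
Proof.
move=> rf rg; apply: (@recursive_ext _
  (fun e => nat_rect (fun=> nat) (f e) (fun i r => r.-1) (g e))).
  by move=> e; elim: (g e) => [|j IH] /=; [lia | rewrite IH; lia].
by apply: recursive_rec => //; apply: recursive_pred; apply: recursive_proj.
Qed.

Lemma recursive_shift k f :
  recursive k f -> recursive k.+2 (fun e => f (fun i => e i.+2)).
Proof.
move=> [c cP]; exists (RecComp c [seq RecProj i | i <- iota 2 k]) => e.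
have E : mkseq (fun i => e i.+2) k = [seq e i | i <- iota 2 k].
  by rewrite (iotaDl 2 0) -map_comp.
apply: computes_comp (cP _); rewrite E; apply: computes_projs.
by apply/allP => i; rewrite mem_iota => /andP[].
Qed.
Lemma recursive_if_eq k f g a b :
  recursive k f -> recursive k g -> recursive k a -> recursive k b ->
  recursive k (fun e => if f e == g e then a e else b e).
Proof.
(* The sum of the two truncated differences vanishes exactly when the values agree; a recursion
   whose step ignores the previous value tests it for zero. *)
move=> rf rg ra rb; apply: (@recursive_ext _ (fun e => nat_rect (fun=> nat)
   (a e) (fun i r => b e) ((f e - g e) + (g e - f e)))).
  move=> e; case: eqP => [->|]; first by rewrite subnn.
  by case E: (_ + _) => //; lia.
apply: (@recursive_rec k _ a (fun i r => b)) => //.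
  by apply: recursive_add; apply: recursive_sub.
exact: recursive_shift rb.
Qed.

(** * Cantor pairing and its inverses *)

Lemma recursive_bin2 k f : recursive k f -> recursive k (fun e => 'C(f e, 2)).
Proof.
move=> rf; apply: (@recursive_ext _
  (fun e => nat_rect (fun=> nat) 0 (fun i r => r + i) (f e))).
  by move=> e; elim: (f e) => // j /= ->; rewrite binS bin1.
apply: recursive_rec => //; first exact: recursive_const.
by apply: recursive_add; apply: recursive_proj.
Qed.

Lemma recursive_cpair k f g :
  recursive k f -> recursive k g -> recursive k (fun e => cpair (f e) (g e)).
Proof.
move=> rf rg; apply: recursive_add => //; apply: recursive_bin2.
by apply: recursive_succ; apply: recursive_add.
Qed.

(* [cdiag (cpair x y) = x + y]: the largest [w] with ['C(w.+1, 2) <= m]. *)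
Definition cdiag (m : nat) : nat :=
  nat_rect (fun=> nat) 0
    (fun i w => if 'C(w.+2, 2) - i.+1 == 0 then w.+1 else w) m.
Definition csnd (m : nat) : nat := m - 'C((cdiag m).+1, 2).
Definition cfst (m : nat) : nat := cdiag m - csnd m.

Lemma bin2S w : 'C(w.+1, 2) = 'C(w, 2) + w.
Proof. by rewrite binS bin1. Qed.

(** Raising [m] by one passes at most one triangular number, so raising the diagonal by at most one
    per step is enough. *)
Lemma cdiag_bounds m : 'C((cdiag m).+1, 2) <= m < 'C((cdiag m).+2, 2).
Proof.
elim: m => // m.
have -> : cdiag m.+1 =
  if 'C((cdiag m).+2, 2) - m.+1 == 0 then (cdiag m).+1 else cdiag m by [].
have := bin2S (cdiag m).+2; rewrite subn_eq0.
case: (leqP 'C((cdiag m).+2, 2) m.+1) => H E /andP[H1 H2].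
  by apply/andP; split; lia.
by apply/andP; split; lia.
Qed.

(** The intervals between consecutive triangular numbers are disjoint, and [cpair x y] lies in the
    one with index [x + y]. *)
Lemma cdiag_cpair x y : cdiag (cpair x y) = x + y.
Proof.
have := cdiag_bounds (cpair x y); set w := cdiag _.
have mono a b : a < b -> 'C(a.+2, 2) <= 'C(b.+1, 2).
  by move=> ab; apply: leq_bin2l.
rewrite /cpair; have := bin2S (x + y).+1.
by case: (ltngtP w (x + y)) => // /mono; lia.
Qed.

Lemma cpairK2 x y : csnd (cpair x y) = y.
Proof. by rewrite /csnd cdiag_cpair /cpair addKn. Qed.

Lemma cpairK1 x y : cfst (cpair x y) = x.
Proof. by rewrite /cfst cpairK2 cdiag_cpair addnK. Qed.

Lemma cpair_ge1 x y : x <= cpair x y.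
Proof. by rewrite /cpair bin2S; lia. Qed.

Lemma cpair_ge2 x y : y <= cpair x y.
Proof. exact: leq_addl. Qed.

(** Constructors with subterms have a positive tag, so codes of subterms are strictly smaller and
    can be looked up in the history. *)
Lemma cpair_gt2 x y : 0 < x -> y < cpair x y.
Proof. by rewrite /cpair bin2S; lia. Qed.

Lemma recursive_cdiag k f : recursive k f -> recursive k (fun e => cdiag (f e)).
Proof.
move=> rf; apply: recursive_rec => //; first exact: recursive_const.
apply: recursive_if_eq; try exact: recursive_const; last exact: recursive_proj.
  apply: recursive_sub; last by apply: recursive_succ; apply: recursive_proj.
  by apply: recursive_bin2; do 2 apply: recursive_succ; apply: recursive_proj.
by apply: recursive_succ; apply: recursive_proj.
Qed.

Lemma recursive_csnd k f : recursive k f -> recursive k (fun e => csnd (f e)).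
Proof.
move=> rf; apply: recursive_sub => //; apply: recursive_bin2.
by apply: recursive_succ; apply: recursive_cdiag.
Qed.

Lemma recursive_cfst k f : recursive k f -> recursive k (fun e => cfst (f e)).
Proof.
move=> rf; apply: recursive_sub; first exact: recursive_cdiag.
exact: recursive_csnd.
Qed.

(* Course-of-values recursion: [history g m] packs the values at [0, .., m - 1],
   the last one outermost. *)
Definition history (g : nat -> nat -> nat) (m : nat) : nat :=
  nat_rect (fun=> nat) 0 (fun i h => cpair h (g i h)) m.
Definition cov_rec (g : nat -> nat -> nat) (m : nat) : nat := g m (history g m).
Definition lookup (m h i : nat) : nat :=
  csnd (nat_rect (fun=> nat) h (fun _ r => cfst r) (m - i.+1)).

(** The value at [i] lies under the [m - i.+1] later ones, each of which is removed by one
    [cfst]. *)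
Lemma lookup_history g m i : i < m -> lookup m (history g m) i = cov_rec g i.
Proof.
move=> im; rewrite /lookup.
suff pop j k : nat_rect (fun=> nat) (history g (j + k)) (fun _ => cfst) j
    = history g k.
  by rewrite -{1}(subnK im) pop /= cpairK2.
elim: j k => //= j IH k.
by have := IH k.+1; rewrite addnS => ->; rewrite /= cpairK1.
Qed.

Lemma recursive_lookup k m h i :
  recursive k m -> recursive k h -> recursive k i ->
  recursive k (fun e => lookup (m e) (h e) (i e)).
Proof.
move=> rm rh ri; apply: recursive_csnd; apply: recursive_rec => //.
  by apply: recursive_sub => //; apply: recursive_succ.
by apply: recursive_cfst; apply: recursive_proj.
Qed.

Lemma recursive_cov_rec k m g :
  recursive k m ->
  recursive k.+2 (fun e => g (e 0) (e 1) (fun i => e i.+2)) ->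
  recursive k (fun e => cov_rec (fun i h => g i h e) (m e)).
Proof.
move=> rm rg.
have rh : recursive k (fun e => history (fun i h => g i h e) (m e)).
  apply: (@recursive_rec k m (fun=> 0) (fun i h e => cpair h (g i h e))) => //.
    exact: recursive_const.
  by apply: recursive_cpair => //; apply: recursive_proj.
exact: (recursive_subst rg rm rh).
Qed.

(** * The translation *)

Notation term_code := field_term_code.
Notation form_code := (formula_code field_atom_code).

(* Block [b] of real variables holds a vector of [C^n]: the real ([c = 0]) and
   imaginary ([c = 1]) parts of its coordinates. *)
Definition rvar (c b j : nat) : nat := cpair c (cpair b j).

(* Blocks 0 and 1 are auxiliary; the lattice variable [x] becomes the blocks
   [block x i], [i < n], standing for the subspace orthogonal to all these
   vectors. *)
Definition block (x i : nat) : nat := (cpair x i).+2.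

Definition dot_sum (n c b c' b' : nat) : field_term :=
  nat_rect (fun=> field_term) RZero
    (fun j r => RAdd r (RMul (RVar (rvar c b j)) (RVar (rvar c' b' j)))) n.

(** Vanishing of the real and of the imaginary part of the Hermitian product; the latter is an
    equation between two sums because the language has no subtraction. *)
Definition dot_eq0 (n b b' : nat) : formula field_atom :=
  FAnd (FAtom (REq (RAdd (dot_sum n 0 b 0 b') (dot_sum n 1 b 1 b')) RZero))
       (FAtom (REq (dot_sum n 1 b 0 b') (dot_sum n 0 b 1 b'))).

Definition in_var (n b x : nat) : formula field_atom :=
  nat_rect (fun=> formula field_atom) (FAtom (REq RZero RZero))
    (fun i r => FAnd r (dot_eq0 n b (block x i))) n.

Definition all_vec (n b : nat) (F : formula field_atom) : formula field_atom :=
  nat_rect (fun=> formula field_atom) F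
    (fun j r => FForall (rvar 0 b j) (FForall (rvar 1 b j) r)) n.

Definition all_space (n x : nat) (F : formula field_atom)
    : formula field_atom :=
  nat_rect (fun=> formula field_atom) F (fun i r => all_vec n (block x i) r) n.

(* [F] speaks about the vector in block [~~ b]. *)
Definition in_compl (n : nat) (b : bool) (F : formula field_atom)
    : formula field_atom :=
  all_vec n (~~ b) (FImp F (dot_eq0 n b (~~ b))).

Fixpoint in_term (n : nat) (b : bool) (t : lattice_term) : formula field_atom :=
  match t with
  | LVar x => in_var n b x
  | LMeet s t => FAnd (in_term n b s) (in_term n b t)
  | LJoin s t => in_compl n b (FAnd (in_compl n (~~ b) (in_term n b s))
                                    (in_compl n (~~ b) (in_term n b t)))
  | LCompl t => in_compl n b (in_term n (~~ b) t)
  end.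

(** An existential quantifier becomes a negated universal one, so that only universal blocks have to
    be built and analysed. *)
Fixpoint to_reals (n : nat) (phi : formula lattice_atom) : formula field_atom :=
  match phi with
  | FAtom (LEq s t) =>
      all_vec n 0 (FAnd (FImp (in_term n false s) (in_term n false t))
                        (FImp (in_term n false t) (in_term n false s)))
  | FNot p => FNot (to_reals n p)
  | FAnd p q => FAnd (to_reals n p) (to_reals n q)
  | FOr p q => FOr (to_reals n p) (to_reals n q)
  | FImp p q => FImp (to_reals n p) (to_reals n q)
  | FForall x p => all_space n x (to_reals n p)
  | FExists x p => FNot (all_space n x (FNot (to_reals n p)))
  end.

(** * Computability of the translation *)

Ltac recursive_step :=
  match goal with
  | |- recursive _ (fun=> ?c) => exact (recursive_const _ c)
  | |- recursive _ (fun e => e _) => apply: recursive_proj; exact: isT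
  | |- _ => eassumption
  | H : recursive _ _ |- _ => exact (recursive_shift H)
  | H : recursive _ _ |- _ => exact (recursive_shift (recursive_shift H))
  | |- recursive _ (fun e => cpair (@?f e) (@?g e)) =>
      apply: (@recursive_cpair _ f g)
  | |- recursive _ (fun e => (@?f e).+1) => apply: (@recursive_succ _ f)
  | |- recursive _ (fun e => cfst (@?f e)) => apply: (@recursive_cfst _ f)
  | |- recursive _ (fun e => csnd (@?f e)) => apply: (@recursive_csnd _ f)
  | |- recursive _ (fun e => lookup (@?f e) (@?g e) (@?h e)) =>
      apply: (@recursive_lookup _ f g h)
  end.

Lemma recursive_dot_sum k n c b c' b' :
  recursive k n -> recursive k b -> recursive k b' ->
  recursive k (fun e => term_code (dot_sum (n e) c (b e) c' (b' e))).
Proof.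
move=> rn rb rb'.
pose v c b j := cpair 0 (rvar c b j).
apply: (@recursive_ext _ (fun e => nat_rect (fun=> nat) (cpair 1 0)
  (fun j r => cpair 3 (cpair r (cpair 4 (cpair (v c (b e) j) (v c' (b' e) j)))))
  (n e))).
  by move=> e; elim: (n e) => // j /= ->.
by apply: recursive_rec; rewrite /v /rvar; repeat recursive_step.
Qed.

Lemma recursive_dot_eq0 k n b b' :
  recursive k n -> recursive k b -> recursive k b' ->
  recursive k (fun e => form_code (dot_eq0 (n e) (b e) (b' e))).
Proof.
move=> rn rb rb'; rewrite /dot_eq0.
cbn [formula_code field_atom_code term_code].
by repeat first [recursive_step | apply: recursive_dot_sum].
Qed.

Lemma recursive_in_var k n b x :
  recursive k n -> recursive k b -> recursive k x ->
  recursive k (fun e => form_code (in_var (n e) (b e) (x e))).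
Proof.
move=> rn rb rx.
apply: (@recursive_ext _ (fun e => nat_rect (fun=> nat)
    (form_code (FAtom (REq RZero RZero)))
  (fun i r => cpair 2 (cpair r
     (form_code (dot_eq0 (n e) (b e) (block (x e) i)))))
  (n e))).
  (* Only the number of vectors varies in the induction; the dimension inside [dot_eq0] stays
     [n e]. *)
  by move=> e; rewrite /in_var; elim: {2 4}(n e) => // j; cbn => ->.
apply: recursive_rec; rewrite /block; repeat recursive_step.
pose b' e := (cpair (x (fun i => e i.+2)) (e 0)).+2.
have rb' : recursive k.+2 b' by rewrite /b'; repeat recursive_step.
by apply: (recursive_dot_eq0 (b' := b')); repeat recursive_step.
Qed.

(** A program sees the body of a quantifier block only through its code [m], so the syntactic
    constructions are repeated on codes. *)
Definition all_vec_code (n b m : nat) : nat :=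
  nat_rect (fun=> nat) m
    (fun j r =>
       cpair 5 (cpair (rvar 0 b j) (cpair 5 (cpair (rvar 1 b j) r)))) n.

Lemma all_vec_codeE n b F :
  form_code (all_vec n b F) = all_vec_code n b (form_code F).
Proof.
rewrite /all_vec /all_vec_code; elim: n => // n IH.
by cbn [nat_rect formula_code]; rewrite IH.
Qed.

Lemma recursive_all_vec k n b m :
  recursive k n -> recursive k b -> recursive k m ->
  recursive k (fun e => all_vec_code (n e) (b e) (m e)).
Proof.
by move=> rn rb rm; apply: recursive_rec; rewrite /rvar; repeat recursive_step.
Qed.

Definition all_space_code (n x m : nat) : nat :=
  nat_rect (fun=> nat) m (fun i r => all_vec_code n (block x i) r) n.

Lemma all_space_codeE n x F :
  form_code (all_space n x F) = all_space_code n x (form_code F).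
Proof.
rewrite /all_space /all_space_code; elim: {2 4}n => // i IH.
by cbn [nat_rect]; rewrite all_vec_codeE IH.
Qed.

Lemma recursive_all_space k n x m :
  recursive k n -> recursive k x -> recursive k m ->
  recursive k (fun e => all_space_code (n e) (x e) (m e)).
Proof.
move=> rn rx rm; apply: recursive_rec => //; rewrite /block.
pose b e := (cpair (x (fun i => e i.+2)) (e 0)).+2.
have rb : recursive k.+2 b by rewrite /b; repeat recursive_step.
by apply: (recursive_all_vec (b := b)); repeat recursive_step.
Qed.

Definition in_compl_code (n b b' m : nat) : nat :=
  all_vec_code n b' (cpair 4 (cpair m (form_code (dot_eq0 n b b')))).

Lemma in_compl_codeE n (b : bool) F :
  form_code (in_compl n b F) = in_compl_code n b (~~ b) (form_code F).
Proof. by rewrite /in_compl all_vec_codeE. Qed.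

Lemma recursive_in_compl k n b b' m :
  recursive k n -> recursive k m ->
  recursive k (fun e => in_compl_code (n e) b b' (m e)).
Proof.
move=> rn rm; apply: recursive_all_vec; repeat recursive_step.
by apply: recursive_dot_eq0; repeat recursive_step.
Qed.

(* The codes of [in_term n false t] and [in_term n true t] are computed
   together; [pr] extracts the component of [b], and [pr'] the other one. *)
Definition in_term_body (n b b' : nat) (pr pr' : nat -> nat) (m h : nat)
    : nat :=
  if cfst m == 0 then form_code (in_var n b (csnd m))
  else if cfst m == 1 then
    cpair 2 (cpair (pr (lookup m h (cfst (csnd m))))
                   (pr (lookup m h (csnd (csnd m)))))
  else if cfst m == 2 then
    in_compl_code n b b' (cpair 2 (cpair
      (in_compl_code n b' b (pr (lookup m h (cfst (csnd m)))))
      (in_compl_code n b' b (pr (lookup m h (csnd (csnd m)))))))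
  else in_compl_code n b b' (pr' (lookup m h (csnd m))).

Definition in_term_step (n m h : nat) : nat :=
  cpair (in_term_body n 0 1 cfst csnd m h) (in_term_body n 1 0 csnd cfst m h).

Lemma cov_rec_unfold g m : cov_rec g m = g m (history g m).
Proof. by []. Qed.

Lemma cpair_lt21 c x y : 0 < c -> x < cpair c (cpair x y).
Proof.
by move=> c_gt0; apply: leq_ltn_trans (cpair_ge1 _ _) (cpair_gt2 _ _).
Qed.

Lemma cpair_lt22 c x y : 0 < c -> y < cpair c (cpair x y).
Proof.
by move=> c_gt0; apply: leq_ltn_trans (cpair_ge2 _ _) (cpair_gt2 _ _).
Qed.

Lemma in_term_codeE n t :
  cov_rec (in_term_step n) (lattice_term_code t) =
  cpair (form_code (in_term n false t)) (form_code (in_term n true t)).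
Proof.
elim: t => [x|s IHs t IHt|s IHs t IHt|t IHt];
  rewrite cov_rec_unfold; set h := history _ _; cbn [lattice_term_code in_term];
  rewrite /in_term_step /in_term_body !cpairK1 !cpairK2 /= ?cpairK1 ?cpairK2
    ?lookup_history ?cpair_lt21 ?cpair_lt22 ?cpair_gt2 //.
- by rewrite IHs IHt !cpairK1 !cpairK2.
- by rewrite IHs IHt !cpairK1 !cpairK2 !in_compl_codeE /= !in_compl_codeE.
- by rewrite IHt cpairK1 cpairK2 !in_compl_codeE.
Qed.

Lemma recursive_in_term_body k n b b' pr pr' m h :
  (forall k f, recursive k f -> recursive k (fun e => pr (f e))) ->
  (forall k f, recursive k f -> recursive k (fun e => pr' (f e))) ->
  recursive k n -> recursive k m -> recursive k h ->
  recursive k (fun e => in_term_body (n e) b b' pr pr' (m e) (h e)).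
Proof.
move=> rpr rpr' rn rm rh; rewrite /in_term_body.
have rs : recursive k (fun e => pr (lookup (m e) (h e) (cfst (csnd (m e))))).
  by apply: rpr; repeat recursive_step.
have rt : recursive k (fun e => pr (lookup (m e) (h e) (csnd (csnd (m e))))).
  by apply: rpr; repeat recursive_step.
apply: recursive_if_eq; [by repeat recursive_step..| |].
  by apply: recursive_in_var; repeat recursive_step.
apply: recursive_if_eq; [by repeat recursive_step..|].
apply: recursive_if_eq; [by repeat recursive_step..| |].
  by repeat first [recursive_step | apply: recursive_in_compl].
by apply: recursive_in_compl => //; apply: rpr'; repeat recursive_step.
Qed.

Lemma recursive_in_term k n m :
  recursive k n -> recursive k m ->
  recursive k (fun e => cov_rec (in_term_step (n e)) (m e)).
Proof.
move=> rn rm.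
apply: (recursive_cov_rec (g := fun i h e => in_term_step (n e) i h)) => //.
apply: recursive_cpair; apply: recursive_in_term_body;
  by [exact: recursive_cfst | exact: recursive_csnd | repeat recursive_step].
Qed.

(** Term codes go through their own course-of-values recursion, of which [cfst] selects the formula
    about block 0. Tags 2, 3 and 4 share the last branch because binary connectives keep their
    tag. *)
Definition to_reals_step (n m h : nat) : nat :=
  if cfst m == 0 then
    let S := cfst (cov_rec (in_term_step n) (cfst (csnd m))) in
    let T := cfst (cov_rec (in_term_step n) (csnd (csnd m))) in
    all_vec_code n 0
      (cpair 2 (cpair (cpair 4 (cpair S T)) (cpair 4 (cpair T S))))
  else if cfst m == 1 then cpair 1 (lookup m h (csnd m))
  else if cfst m == 5 then
    all_space_code n (cfst (csnd m)) (lookup m h (csnd (csnd m)))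
  else if cfst m == 6 then
    cpair 1 (all_space_code n (cfst (csnd m))
               (cpair 1 (lookup m h (csnd (csnd m)))))
  else cpair (cfst m) (cpair (lookup m h (cfst (csnd m)))
                             (lookup m h (csnd (csnd m)))).

Lemma to_reals_codeE n phi :
  cov_rec (to_reals_step n) (formula_code lattice_atom_code phi) =
  form_code (to_reals n phi).
Proof.
elim: phi => [[s t]|p IHp|p IHp q IHq|p IHp q IHq|p IHp q IHq|x p IHp|x p IHp];
  rewrite cov_rec_unfold; set h := history _ _;
  cbn [formula_code lattice_atom_code to_reals];
  rewrite /to_reals_step !cpairK2 ?(cpairK1 (lattice_term_code _))
    ?in_term_codeE !cpairK1 /= ?cpairK1 ?cpairK2
    ?lookup_history ?cpair_lt21 ?cpair_lt22 ?cpair_gt2 ?IHp ?IHq //.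
- by rewrite all_vec_codeE.
- by rewrite all_space_codeE.
- by rewrite all_space_codeE.
Qed.

Lemma recursive_to_reals k n m :
  recursive k n -> recursive k m ->
  recursive k (fun e => cov_rec (to_reals_step (n e)) (m e)).
Proof.
move=> rn rm.
apply: (recursive_cov_rec (g := fun i h e => to_reals_step (n e) i h)) => //.
rewrite /to_reals_step.
apply: recursive_if_eq; [by repeat recursive_step..| |].
  apply: recursive_all_vec; [by repeat recursive_step..|].
  by repeat first [recursive_step | apply: recursive_in_term].
apply: recursive_if_eq; [by repeat recursive_step..|].
apply: recursive_if_eq; [by repeat recursive_step..| |].
  by apply: recursive_all_space; repeat recursive_step.
by apply: recursive_if_eq;
  repeat first [recursive_step | apply: recursive_all_space].
Qed.

(** * Free variables of the translated formulas *)

Fixpoint in_block (n b y : nat) : bool :=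
  if n is j.+1 then [|| y == rvar 0 b j, y == rvar 1 b j | in_block j b y]
  else false.

Definition in_space (n x y : nat) : bool :=
  nat_rect (fun=> bool) false (fun i r => r || in_block n (block x i) y) n.

Notation form_fv := (formula_fv field_atom_fv).

Lemma fv_all_vec n b F y :
  (y \in form_fv (all_vec n b F)) = (y \in form_fv F) && ~~ in_block n b y.
Proof.
elim: n => [|j IH]; first by rewrite andbT.
cbn [all_vec nat_rect formula_fv in_block]; rewrite !mem_filter IH.
by do 2 case: (y == rvar _ _ _); rewrite ?andbF ?andbT.
Qed.

Lemma fv_all_space n x F y :
  (y \in form_fv (all_space n x F)) = (y \in form_fv F) && ~~ in_space n x y.
Proof.
rewrite /all_space /in_space; elim: {2 4}n => [|i IH]; first by rewrite andbT.
by cbn [nat_rect]; rewrite fv_all_vec IH negb_or andbA.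
Qed.

Lemma fv_dot_sum n c b c' b' y : c < 2 -> c' < 2 ->
  y \in field_term_fv (dot_sum n c b c' b') ->
  in_block n b y || in_block n b' y.
Proof.
move=> c2 c2'; elim: n => // j IH.
cbn [dot_sum nat_rect field_term_fv in_block].
rewrite mem_cat => /orP[/IH/orP[->|->]|]; rewrite ?orbT // mem_cat !inE.
by case: c c2 {IH} => [|[|]] //; case: c' c2' => [|[|]] // _ _ /orP[]->;
  rewrite ?orbT.
Qed.

Lemma fv_dot_eq0 n b b' y :
  y \in form_fv (dot_eq0 n b b') -> in_block n b y || in_block n b' y.
Proof.
cbn [dot_eq0 formula_fv field_atom_fv field_term_fv].
rewrite cats0 !mem_cat.
by move=> /orP[]/orP[]; apply: fv_dot_sum.
Qed.

Lemma fv_in_var n b x y :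
  y \in form_fv (in_var n b x) -> in_block n b y || in_space n x y.
Proof.
rewrite /in_var /in_space; elim: {2 5}n => // i IH.
cbn [nat_rect formula_fv]; rewrite mem_cat.
by move=> /orP[/IH|/fv_dot_eq0] /orP[]->; rewrite ?orbT.
Qed.

(** Block [~~ b] gets bound and block [b] enters through the product; [P] stands for the blocks of
    the lattice variables, which are left alone. *)
Lemma fv_in_compl n b F y (P : bool) :
  (y \in form_fv F -> in_block n (~~ b) y || P) ->
  y \in form_fv (in_compl n b F) -> in_block n b y || P.
Proof.
move=> FP; rewrite fv_all_vec; cbn [formula_fv]; rewrite mem_cat.
case/andP=> /orP[/FP|/fv_dot_eq0] /orP[]->; rewrite ?orbT //.
Qed.

Lemma fv_in_term n b t y :
  y \in form_fv (in_term n b t) ->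
  in_block n b y || has (in_space n ^~ y) (lattice_term_fv t).
Proof.
elim: t b => [x|s IHs t IHt|s IHs t IHt|t IHt] b;
  cbn [in_term lattice_term_fv formula_fv].
- by move/fv_in_var; rewrite /= orbF.
- by rewrite mem_cat has_cat => /orP[/IHs|/IHt] /orP[]->; rewrite ?orbT.
- apply: fv_in_compl; cbn [formula_fv]; rewrite mem_cat => /orP[].
    apply: fv_in_compl; rewrite negbK has_cat => /IHs /orP[]->;
      by rewrite ?orbT.
  by apply: fv_in_compl; rewrite negbK has_cat => /IHt /orP[]->;
    rewrite ?orbT.
- by apply: fv_in_compl => /IHt.
Qed.

Lemma fv_to_reals n phi y :
  y \in form_fv (to_reals n phi) ->
  has (in_space n ^~ y) (formula_fv lattice_atom_fv phi).
Proof.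
have quant F x p : (y \in F -> has (in_space n ^~ y) p) ->
    (y \in F) && ~~ in_space n x y ->
    has (in_space n ^~ y) [seq z <- p | z != x].
  move=> IH /andP[/IH/hasP[z zp zy] xy]; apply/hasP; exists z => //.
  by rewrite mem_filter zp andbT; apply: contraNneq xy => <-.
elim: phi => [[s t]|p IHp|p IHp q IHq|p IHp q IHq|p IHp q IHq|x p IHp|x p IHp];
  cbn [to_reals formula_fv lattice_atom_fv];
  rewrite ?mem_cat ?has_cat; try by [|move=> /orP[/IHp|/IHq]->; rewrite ?orbT].
- rewrite fv_all_vec; cbn [formula_fv]; rewrite !mem_cat.
  by case/andP=> /orP[]/orP[]/fv_in_term/orP[]; move=> -> //; rewrite orbT.
- by rewrite fv_all_space; apply: quant.
- by rewrite fv_all_space; apply: quant.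
Qed.

Lemma to_reals_closed n (phi : lattice_sentence) :
  form_fv (to_reals n phi) = [::].
Proof.
case E: (form_fv _) => [//|y s].
have /fv_to_reals : y \in form_fv (to_reals n phi) by rewrite E mem_head.
by rewrite (sentence_closed phi).
Qed.

Definition star (n : nat) (phi : lattice_sentence) : field_sentence :=
  Sentence (to_reals_closed n phi).

Lemma effective_star : effective star.
Proof.
have [c cP] : recursive 2 (fun e => cov_rec (to_reals_step (e 0)) (e 1)).
  by apply: recursive_to_reals; apply: recursive_proj.
exists c => n phi; rewrite -to_reals_codeE.
(* At arity 2 the argument list consists of the first two entries of this environment. *)
exact: (cP (env_cons n (env_cons (formula_code lattice_atom_code phi) id))).
Qed.

(** * Correctness *)

Section Semantics.
Local Open Scope ring_scope.
Variable R : realType.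
Implicit Types (v w : nat -> R).

Notation form_holds := (holds (@real_atom_holds R)).

(** From here on a block of quantifiers is handled as one change of assignment, without regard to
    single variables. *)
Lemma holds_all_vec n b F v :
  form_holds v (all_vec n b F) <->
  (forall w, (forall y, ~~ in_block n b y -> w y = v y) -> form_holds w F).
Proof.
elim: n v => [|j IH] v.
  split=> [Fv w wv|]; last by apply.
  by have -> : w = v by apply/funext => y; apply: wv.
split=> [H w wv|H d d'].
  have /IH := H (w (rvar 0%N b j)) (w (rvar 1%N b j)).
  apply=> y yj /=; case: eqP => [->//|/eqP y1]; case: eqP => [->//|/eqP y0].
  by apply: wv; rewrite /= negb_or y0 negb_or y1.
apply/IH => w wv; apply: H => y.
rewrite /= !negb_or => /and3P[y0 y1 /wv ->] /=.
by rewrite (negPf y0) (negPf y1).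
Qed.

Lemma holds_all_space n x F v :
  form_holds v (all_space n x F) <->
  (forall w, (forall y, ~~ in_space n x y -> w y = v y) -> form_holds w F).
Proof.
rewrite /all_space /in_space; elim: {2 4}n v => [|i IH] v.
  split=> [Fv w wv|]; last by apply.
  by have -> : w = v by apply/funext => y; apply: wv.
cbn [nat_rect]; rewrite holds_all_vec; split=> [H w wv|H w wv].
  (* The outermost quantifiers choose block [i]: [w'] follows [w] there, and the remaining changes
     are left to the induction hypothesis. *)
  pose w' y := if in_block n (block x i) y then w y else v y.
  have /H/IH : forall y, ~~ in_block n (block x i) y -> w' y = v y.
    by move=> y /negPf; rewrite /w' => ->.
  apply=> y yi; rewrite /w'; case: ifPn => // yn.
  by apply: wv; rewrite negb_or yi.
apply/IH => w' w'w; apply: H => y.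
by rewrite negb_or => /andP[/w'w -> /wv].
Qed.

(** * Vectors and subspaces stored in blocks of reals *)

Variable n : nat.
Notation C := R[i].
Notation dot := (@dotmx C n).
Implicit Types (U V : {vspace 'rV[C]_n}) (z : 'rV[C]_n).

Definition vec v b : 'rV[C]_n :=
  \row_j (v (rvar 0%N b j) +i* v (rvar 1%N b j))%C.

Lemma in_blockP b y :
  reflect (exists c, exists2 j, (c < 2)%N && (j < n)%N & y = rvar c b j)
    (in_block n b y).
Proof.
elim: n => [|m IH]; first by constructor=> -[c [j /andP[]]].
cbn [in_block].
apply: (iffP or3P) => [[/eqP->|/eqP->|/IH[c [j /andP[c2 jm] ->]]]|].
- by exists 0%N, m => /=.
- by exists 1%N, m => /=.
- by exists c, j; rewrite // c2 ltnW.
case=> c [j /andP[c2]].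
rewrite ltnS leq_eqVlt => /orP[/eqP->|jm] yE; last first.
  by apply: Or33; apply/IH; exists c, j; rewrite ?c2.
by rewrite yE; case: c c2 {yE} => [|[|]] // _; [apply: Or31 | apply: Or32].
Qed.

Lemma vec_ext v w b :
  (forall y, in_block n b y -> w y = v y) -> vec w b = vec v b.
Proof.
move=> wv; apply/rowP => j; rewrite !mxE.
by congr (_ +i* _)%C; apply: wv; apply/in_blockP;
  [exists 0%N, j | exists 1%N, j] => //=.
Qed.

Lemma holds_dot_eq0 v b b' :
  form_holds v (dot_eq0 n b b') <-> dot (vec v b) (vec v b') = 0.
Proof.
set re := fun b j => v (rvar 0%N b j); set im := fun b j => v (rvar 1%N b j).
have -> : dot (vec v b) (vec v b') =
    ((\sum_(j < n) re b j * re b' j + \sum_(j < n) im b j * im b' j) +i*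
     (\sum_(j < n) im b j * re b' j - \sum_(j < n) re b j * im b' j))%C.
  rewrite dotmxE mxE.
  transitivity (\sum_(j < n) (re b j +i* im b j) * (re b' j -i* im b' j))%C.
    by apply: eq_bigr => j _; rewrite !mxE.
  elim: n => [|m IH]; first by rewrite !big_ord0 addr0 subr0.
  rewrite !big_ord_recr /= IH; apply/eqP; rewrite eq_complex /=.
  by apply/andP; split; apply/eqP; ring.
have dotE c d c' d' : real_eval v (dot_sum n c d c' d') =
    \sum_(j < n) v (rvar c d j) * v (rvar c' d' j).
  elim: n => [|m IH]; first by rewrite big_ord0.
  by rewrite big_ord_recr -IH.
cbn [dot_eq0 holds real_atom_holds real_eval]; rewrite !dotE.
split=> [[-> ->]|/eqP]; first by rewrite subrr.
by rewrite eq_complex /= subr_eq0 => /andP[/eqP-> /eqP->].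
Qed.

(** The vectors of [U] are those killed by the identity minus a projection onto [U]. Conjugate
    transposition turns the columns of that matrix into rows whose Hermitian products with [z] are
    the coordinates of [z - projv U z]. *)
Definition perp U : 'M[C]_n := ((1%:M - lin1_mx (projv U)) ^t* )%sesqui.

Lemma mem_perp U z : z \in U <-> (forall i, dot z (row i (perp U)) = 0).
Proof.
have dotE i : dot z (row i (perp U)) = (z - projv U z) 0 i.
  have -> : z - projv U z = z *m (1%:M - lin1_mx (projv U)).
    by rewrite mulmxBr mulmx1 mul_rV_lin1.
  rewrite dotmxE !mxE.
  by apply: eq_bigr => j _; rewrite !mxE conjCK.
split=> [zU i|H]; first by rewrite dotE projv_id // subrr mxE.
have /eqP : z - projv U z = 0 by apply/rowP => i; rewrite -dotE H mxE.
by rewrite subr_eq0 => /eqP->; apply: memv_proj.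
Qed.

(** The rows of [perp U] are orthogonal to [U], so a vector orthogonal to the whole complement is
    orthogonal to these rows and hence lies in [U]; no dimension count is involved. *)
Lemma orthovK U : orthov dot (orthov dot U) = U.
Proof.
apply/vspaceP => z; apply/mem_orthovP/idP => [H|zU u /mem_orthovP/(_ z zU)/eqP].
  apply/mem_perp => i; apply: H; apply/mem_orthovP => u /mem_perp /(_ i)/eqP.
  by rewrite herm_eq0C => /eqP.
by rewrite herm_eq0C => /eqP.
Qed.

(** This justifies the translation of joins: the complement of a sum is the meet of the complements,
    and complementing is an involution. *)
Lemma orthov_cap U V :
  orthov dot (orthov dot U :&: orthov dot V) = (U + V)%VS.
Proof.
rewrite -[RHS]orthovK; congr orthov; apply/vspaceP => z; rewrite memv_cap.
apply/andP/mem_orthovP => [[/mem_orthovP zU /mem_orthovP zV] s|H].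
  by move=> /memv_addP[u uU [u' u'V ->]]; rewrite linearDr /= zU // zV // addr0.
split; apply/mem_orthovP => u uU; apply: H.
  exact: subvP (addvSl _ _) _ uU.
exact: subvP (addvSr _ _) _ uU.
Qed.

Definition space v x : {vspace 'rV[C]_n} :=
  (\bigcap_(i < n) orthov dot <[vec v (block x i)]>)%VS.

Lemma mem_space v x z :
  z \in space v x <-> (forall i : 'I_n, dot z (vec v (block x i)) = 0).
Proof.
split=> [/subv_bigcapP H i|H].
  by apply/eqP; rewrite -mem_orthov1; apply: H.
by apply/subv_bigcapP => i _; rewrite -memvE mem_orthov1; apply/eqP; apply: H.
Qed.

Lemma in_block_space x i y :
  (i < n)%N -> in_block n (block x i) y -> in_space n x y.
Proof.
rewrite /in_space => + yi; elim: {1 3}n => // m IH; cbn [nat_rect].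
by rewrite ltnS leq_eqVlt => /orP[/eqP<-|/IH->//]; rewrite yi orbT.
Qed.

Lemma space_ext v w x :
  (forall y, in_space n x y -> w y = v y) -> space w x = space v x.
Proof.
move=> wv; apply: eq_bigr => i _; congr (orthov _ <[_]>)%VS.
by apply: vec_ext => y yi; apply: wv; apply: in_block_space yi.
Qed.

Lemma space_surj (f : nat -> {vspace 'rV[C]_n}) :
  exists v, forall x, space v x = f x.
Proof.
(* The number [y] is decoded as [rvar c (block x i) j], with [.-2] undoing the shift in [block], and
   receives a part of the entry [(i, j)] of [perp (f x)]; an index out of range yields 0. *)
pose v y := let c := cfst y in let b := (cfst (csnd y)).-2 in
  let z := if insub (csnd b) is Some i then
             if insub (csnd (csnd y)) is Some j then perp (f (cfst b)) i j
             else 0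
           else 0 in
  if c == 0%N then complex.Re z else complex.Im z.
exists v => x; apply/vspaceP => z.
have rowE (i : 'I_n) : vec v (block x i) = row i (perp (f x)).
  apply/rowP => j; rewrite mxE [RHS]mxE /v !cpairK1 !cpairK2 cpairK1 /=.
  rewrite !cpairK1 !cpairK2.
  rewrite !valK. by case: (perp _ i j).
apply/idP/idP => [/mem_space H|/mem_perp H].
  by apply/mem_perp => i; rewrite -rowE.
by apply/mem_space => i; rewrite rowE.
Qed.

(** * Truth of the translated formulas *)

Lemma holds_in_var v b x :
  form_holds v (in_var n b x) <-> vec v b \in space v x.
Proof.
rewrite mem_space.
have -> : form_holds v (in_var n b x) <->
    (forall i, (i < n)%N -> form_holds v (dot_eq0 n b (block x i))).
  rewrite /in_var; elim: {2 3}n => [|m IH]; first by split.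
  cbn [nat_rect holds]; rewrite IH; split=> [[H Hm] i|H].
    by rewrite ltnS leq_eqVlt => /orP[/eqP->//|/H].
  by split=> [i im|]; apply: H; rewrite // ltnW.
split=> [H i|H i ni]; apply/holds_dot_eq0; first exact: H.
exact: (H (Ordinal ni)).
Qed.

Lemma in_block_inj b y : in_block n b y -> cfst (csnd y) = b.
Proof. by case/in_blockP=> c [j _ ->]; rewrite cpairK2 cpairK1. Qed.

Lemma in_space_inj x y : in_space n x y -> exists i, cfst (csnd y) = block x i.
Proof.
rewrite /in_space; elim: {2}n => //= i IH /orP[/IH//|/in_block_inj].
by exists i.
Qed.

Lemma vec_off_block v w b b' : b != b' ->
  (forall y, ~~ in_block n b y -> w y = v y) -> vec w b' = vec v b'.
Proof.
move=> bb' wv; apply: vec_ext => y yb'; apply: wv.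
by apply: contraNN bb' => /in_block_inj <-; apply/eqP/in_block_inj.
Qed.

(** Blocks of lattice variables are numbered from 2, whereas a boolean [b] names block 0 or 1. *)
Lemma space_off_aux v w (b : bool) :
  (forall y, ~~ in_block n b y -> w y = v y) -> space w = space v.
Proof.
move=> wv; apply/funext => x; apply: space_ext => y /in_space_inj[i yi].
by apply: wv; apply/negP => /in_block_inj; rewrite yi; case: (b).
Qed.

Lemma vec_surj v b z :
  exists2 w, (forall y, ~~ in_block n b y -> w y = v y) & vec w b = z.
Proof.
exists (fun y => if in_block n b y then
    let u := if insub (csnd (csnd y)) is Some j then z 0 j else 0 in
    if cfst y == 0%N then complex.Re u else complex.Im u
  else v y) => [y /negPf->//|].
apply/rowP => j; rewrite mxE.
rewrite !(introT (in_blockP _ _));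
  [|by exists 1%N, j => /=|by exists 0%N, j => /=].
by rewrite !cpairK1 !cpairK2 /= !valK; case: (z 0 j).
Qed.

(** The hypothesis covers every assignment with the same subspaces, whatever its auxiliary vectors;
    this lets nested complements reuse the same two blocks. *)
Lemma holds_in_compl v (b : bool) F U :
  (forall w, space w = space v -> form_holds w F <-> vec w (~~ b) \in U) ->
  form_holds v (in_compl n b F) <-> vec v b \in orthov dot U.
Proof.
move=> FU; rewrite holds_all_vec.
have nb : ~~ b != b :> nat by case: b {FU}.
split=> [H|/mem_orthovP H w wv].
  apply/mem_orthovP => u uU; have [w wv wu] := vec_surj v (~~ b) u.
  rewrite -(vec_off_block nb wv) -wu; apply/holds_dot_eq0/(H w wv).
  by apply/(FU w (space_off_aux wv)); rewrite wu.
move=> /(FU w (space_off_aux wv)) wU; apply/holds_dot_eq0.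
by rewrite (vec_off_block nb wv); apply: H.
Qed.

Lemma holds_in_term v b t :
  form_holds v (in_term n b t) <-> vec v b \in subspace_eval (space v) t.
Proof.
elim: t v b => [x|s IHs t IHt|s IHs t IHt|t IHt] v b;
  cbn [in_term subspace_eval].
- exact: holds_in_var.
- by rewrite memv_cap; cbn [holds]; rewrite IHs IHt; split=> [[-> ->]|/andP].
- rewrite -orthov_cap; apply: holds_in_compl => w wv; cbn [holds].
  rewrite memv_cap (holds_in_compl (U := subspace_eval (space v) s)).
    rewrite (holds_in_compl (U := subspace_eval (space v) t)).
      by split=> [[-> ->]|/andP].
    by move=> u uw; rewrite negbK IHt uw wv.
  by move=> u uw; rewrite negbK IHs uw wv.
- by apply: holds_in_compl => w wv; rewrite IHt wv.
Qed.

Notation space_holds := (holds (@subspace_atom_holds R n)).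

(** Any reals in the blocks of [x] define a subspace, every subspace arises in this way, and the
    blocks of other lattice variables are disjoint from these. *)
Lemma holds_forall_space v x F (P : {vspace 'rV[C]_n} -> Prop) :
  (forall w d,
     space w = [eta space v with x |-> d] -> form_holds w F <-> P d) ->
  form_holds v (all_space n x F) <-> (forall d, P d).
Proof.
move=> FP; rewrite holds_all_space; split=> [H d|H w wv]; last first.
  apply/(FP w (space w x)) => //; apply/funext => y /=; case: eqP => [->//|yx].
  apply: space_ext => k /in_space_inj[i ki]; apply: wv; apply/negP.
  move=> /in_space_inj[i']; rewrite ki => -[/(congr1 cfst)].
  by rewrite !cpairK1.
have [u uE] := space_surj (fun=> d).
pose w y := if in_space n x y then u y else v y.
apply/(FP w d); last by apply: H => y /negPf; rewrite /w => ->.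
apply/funext => y /=; case: eqP => [->|yx].
  by rewrite -(uE x); apply: space_ext => k; rewrite /w => ->.
apply: space_ext => k /in_space_inj[i ki]; rewrite /w; case: ifP => //.
by move=> /in_space_inj[i']; rewrite ki => -[/(congr1 cfst)]; rewrite !cpairK1.
Qed.

Lemma holds_to_reals v phi :
  form_holds v (to_reals n phi) <-> space_holds (space v) phi.
Proof.
elim: phi v =>
  [[s t]|p IHp|p IHp q IHq|p IHp q IHq|p IHp q IHq|x p IHp|x p IHp] v;
  cbn [to_reals holds subspace_atom_holds]; rewrite ?IHp ?IHq //.
- rewrite holds_all_vec; split=> [H|st w wv].
    apply/vspaceP => z; have [w wv <-] := vec_surj v 0 z.
    have := H w wv; cbn [holds].
    rewrite !holds_in_term (@space_off_aux v w false) // => -[st ts].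
    by apply/idP/idP.
  by cbn [holds]; rewrite !holds_in_term (@space_off_aux v w false) // st.
- by apply: holds_forall_space => w d <-.
- rewrite (@holds_forall_space _ _ _
    (fun d => ~ space_holds [eta space v with x |-> d] p)).
    by rewrite forallNE; split=> [/contrapT | e]; last apply.
  by move=> w d <-; cbn [holds]; rewrite IHp.
Qed.
End Semantics.

Theorem theorem2 (R : realType) :
  exists star : nat -> lattice_sentence -> field_sentence,
    effective star /\
    forall (n : nat) (phi : lattice_sentence),
      subspaces_model R n phi <-> reals_model R (star n phi).
Proof.
exists star; split; first exact: effective_star.
move=> n phi; split=> [H v|H f]; first by apply/holds_to_reals.
(* An arbitrary assignment of subspaces comes from an assignment of reals, to which the hypothesis
   applies. *)
have [v vf] := space_surj f.
by rewrite -(funext vf); apply/holds_to_reals.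
Qed.
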